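(* For the oblivious vertex equality problem based on the extended YO-13 set (defined in the context), the optimal classical value $S^{(2)}_c$ of the figure of merit $$S^{(2)}=\frac{1}{58}\sum_{x=1}^{25}c_x\left(p(0|x,x)+\sum_{y\in N_x}p(1|x,y)\right)$$ is $0.92$ (rounded to two decimal places).
   Context: Extended YO-13 graph: vertices $\{1,\dots,25\}$; two distinct vertices are adjacent iff they both belong to one of the sixteen sets $\Omega_1=\{1,2,3\}$, $\Omega_2=\{1,4,5\}$, $\Omega_3=\{2,6,7\}$, $\Omega_4=\{3,8,9\}$, $\Omega_5=\{5,10,14\}$, $\Omega_6=\{6,10,15\}$, $\Omega_7=\{7,11,16\}$, $\Omega_8=\{8,11,17\}$, $\Omega_9=\{9,12,18\}$, $\Omega_{10}=\{4,12,19\}$, $\Omega_{11}=\{5,13,20\}$, $\Omega_{12}=\{7,13,21\}$, $\Omega_{13}=\{9,13,22\}$, $\Omega_{14}=\{6,12,23\}$, $\Omega_{15}=\{8,10,24\}$, $\Omega_{16}=\{4,11,25\}$. (This is the orthogonality graph of the 13 vectors of Yu and Oh in dimension 3, extended by 12 vectors so that each vector belongs to a basis.) $N_x$ denotes the set of neighbors of $x$. Two additional sets (used only in the oblivious constraints and weights, not for adjacency) are $\Omega_{17}=\{4,5,6,7,8,9\}$ and $\Omega_{18}=\{10,11,12,13\}$. Weights: $c_x=m_x/(|N_x|+1)$, where $m_x$ is the number of sets among $\Omega_1,\dots,\Omega_{18}$ containing $x$; explicitly $c_x=2/5$ for $x\in\{1,2,3\}$, $c_x=4/7$ for $x\in\{4,\dots,13\}$,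 $c_x=1/3$ for $x\in\{14,\dots,25\}$. The normalization is $\sum_{w=1}^{18}|\Omega_w|=58$. Task: Alice receives $x$ and Bob receives $y$ from $\{1,\dots,25\}$; Alice sends a classical message to Bob, who outputs $z\in\{0,1\}$; the correct answer is $0$ if $y=x$ and $1$ if $y\in N_x$. Classical oblivious strategy: an arbitrary positive integer $L$, conditional probabilities $p_e(\tau|x)$, $\tau\in\{1,\dots,L\}$, with $\sum_\tau p_e(\tau|x)=1$, and $p_d(z|y,\tau)$ with $p_d(0|y,\tau)+p_d(1|y,\tau)=1$, such that for each $\tau$ the quantity $\frac{1}{|\Omega_w|}\sum_{x\in\Omega_w}p_e(\tau|x)$ is the same for all $w\in\{1,\dots,18\}$. Observed probabilities: $p(z|x,y)=\sum_\tau p_e(\tau|x)p_d(z|y,\tau)$. $S^{(2)}_c$ is the supremum of $S^{(2)}$ over all $L$ and all such strategies. *)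

(* Defs.v *)
From mathcomp Require Import all_boot all_order all_algebra.
From mathcomp Require Import boolp classical_sets reals.

Set Implicit Arguments.
Unset Strict Implicit.
Unset Printing Implicit Defensive.

Import Order.TTheory GRing.Theory Num.Theory.
Local Open Scope ring_scope.

(* The vertex labelled k (1 <= k <= 25) is the element of 'I_25 of value k - 1,
   and Omega_w (1 <= w <= 18) is indexed by the element of 'I_18 of value
   w - 1. *)
Definition vertex := 'I_25.

Definition Omega_labels : seq (seq nat) :=
  [:: [:: 1; 2; 3];    [:: 1; 4; 5];    [:: 2; 6; 7];    [:: 3; 8; 9];
      [:: 5; 10; 14];  [:: 6; 10; 15];  [:: 7; 11; 16];  [:: 8; 11; 17];
      [:: 9; 12; 18];  [:: 4; 12; 19];  [:: 5; 13; 20];  [:: 7; 13; 21];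
      [:: 9; 13; 22];  [:: 6; 12; 23];  [:: 8; 10; 24];  [:: 4; 11; 25];
      [:: 4; 5; 6; 7; 8; 9];
      [:: 10; 11; 12; 13] ]%N.

Definition Omega (w : 'I_18) : {set vertex} :=
  [set x : vertex | x.+1 \in nth [::] Omega_labels w].

(* Only Omega_1, ..., Omega_16 define adjacency. *)
Definition adj (x y : vertex) : bool :=
  (x != y) && [exists w : 'I_18, [&& (w < 16)%N, x \in Omega w & y \in Omega w]].

Definition nbrs (x : vertex) : {set vertex} := [set y | adj x y].

Definition mult (x : vertex) : nat := #|[set w : 'I_18 | x \in Omega w]|.

Definition weight (R : realType) (x : vertex) : R :=
  (mult x)%:R / (#|nbrs x|.+1)%:R.

(* [pe tau x] is p_e(tau|x) and [pd z y tau] is p_d(z|y,tau); Bob's output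
   z in {0,1} is a boolean, with [false] for 0 and [true] for 1. *)
Record oblivious_strategy (R : realType) (L : nat)
    (pe : 'I_L -> vertex -> R) (pd : bool -> vertex -> 'I_L -> R) : Prop :=
  ObliviousStrategy {
    pe_ge0 : forall tau x, 0 <= pe tau x;
    pe_sum1 : forall x, \sum_tau pe tau x = 1;
    pd_ge0 : forall z y tau, 0 <= pd z y tau;
    pd_sum1 : forall y tau, pd false y tau + pd true y tau = 1;
    pe_oblivious : forall tau (w w' : 'I_18),
      (#|Omega w|%:R)^-1 * (\sum_(x in Omega w) pe tau x) =
      (#|Omega w'|%:R)^-1 * (\sum_(x in Omega w') pe tau x)
  }.

Definition observed (R : realType) (L : nat)
    (pe : 'I_L -> vertex -> R) (pd : bool -> vertex -> 'I_L -> R)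
    (z : bool) (x y : vertex) : R :=
  \sum_tau pe tau x * pd z y tau.

Definition figure_of_merit (R : realType) (p : bool -> vertex -> vertex -> R) : R :=
  (58%:R)^-1 *
  \sum_x weight R x * (p false x x + \sum_(y in nbrs x) p true x y).

Definition classical_values (R : realType) : set R :=
  [set s | exists (L : nat) (pe : 'I_L -> vertex -> R)
                  (pd : bool -> vertex -> 'I_L -> R),
     [/\ (0 < L)%N, oblivious_strategy pe pd &
         s = figure_of_merit (observed pe pd)]]%classic.

Arguments classical_values R : clear implicits.

(* [sup] is 0 on a set that is empty or unbounded above, so a positive lower
   bound on this value implies that the supremum exists. *)
Definition S_classical (R : realType) : R := sup (classical_values R).

(* Main.v *)
From Stdlib Require Import BinInt.
Require Import Defs.
From mathcomp Require Import all_boot all_order all_algebra.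
From mathcomp Require Import boolp classical_sets reals.
From mathcomp Require Import ring lra ssrZ.

(** Since [c_x (|N_x| + 1) = m_x], the terms
    [c_y p_e(tau|y)] and [sum_(x in N_y) c_x p_e(tau|x)] add up over [y] to the
    sum over the 18 sets Omega_w of the mass of Omega_w, i.e. to 58 times the
    common average [q_tau].  As Bob keeps at most the larger term of each pair,
    message [tau] loses at least the sum of the smaller ones, a concave
    piecewise linear function of [p_e(tau|.)].  Its minimum over the polytope of
    oblivious distributions is bounded below by a branch-and-bound tree: each
    node decides which term of one pair is the smaller, and each leaf is closed
    by linear programming duality.  The symmetric group on {10, 11, 12, 13} acts
    on the whole configuration, so only the chamber
    [f 10 <= f 11 <= f 12 <= f 13] is searched.  Conversely, the orbit of one
    good vertex of the polytope averages to the uniform weights, so using its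
    points as messages gives a strategy, of value about 0.9205. *)

Set Implicit Arguments.
Unset Strict Implicit.
Unset Printing Implicit Defensive.

Import Order.TTheory GRing.Theory Num.Theory.
Local Open Scope ring_scope.

(** * Integer data on the labels 1 to 25 *)

Definition labels : seq nat := iota 1 25.

(** A counterpart of [adj] on lists of naturals, so that [vm_compute] can decide it. *)
Definition adj_label (j k : nat) : bool :=
  (j != k) && has (fun l => (j \in l) && (k \in l)) (take 16 Omega_labels).

(* 105 times the weight c_j of the context. *)
Definition coef (j : nat) : Z :=
  if (j <= 3)%N then 42 else if (j <= 13)%N then 60 else 35.

(* Coefficients of a linear form in f 1, ..., f 25. *)
Definition form := nat -> Z.

Definition indicator (l : seq nat) : form := fun j => if j \in l then 1 else 0.

(* 105 times what Bob collects at vertex y on answering z. *)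
Definition piece (z : bool) (y : nat) : form :=
  fun j => if (if z then adj_label y j else y == j) then coef j else 0.

Fixpoint comb (cs : seq Z) (Ls : seq form) : form := fun j =>
  if (cs, Ls) is (c :: cs', L :: Ls') then c * L j + comb cs' Ls' j else 0.

(** The left side counts [coef j] once for [j] itself and once per neighbor of [j]; since
    [c_j * (|N_j| + 1) = m_j], this is 105 times the number of sets containing [j]. *)
Lemma pieces_sum (j : nat) : j \in labels ->
  comb (nseq 25 1) [seq piece false y | y <- labels] j +
  comb (nseq 25 1) [seq piece true y | y <- labels] j =
  comb (nseq 18 105) (map indicator Omega_labels) j.
Proof.
have /allP H : all (fun j =>
    comb (nseq 25 1) [seq piece false y | y <- labels] j +
    comb (nseq 25 1) [seq piece true y | y <- labels] j ==
    comb (nseq 18 105) (map indicator Omega_labels) j) labels.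
  by vm_compute.
by move=> /H /eqP.
Qed.

(** * Evaluation of integer linear forms at real points *)

Section Eval.
Context {R : realType}.
Implicit Types (f : nat -> R) (L : form) (q : R).

(** Coefficients live in the binary integers [Z], where computation is fast; this ring morphism
    carries the computed facts to [R]. *)
Definition ofZ (z : Z) : R := (int_of_Z z)%:~R.

Lemma ofZD a b : ofZ (a + b) = ofZ a + ofZ b.
Proof. by rewrite /ofZ !rmorphD. Qed.

Lemma ofZM a b : ofZ (a * b) = ofZ a * ofZ b.
Proof. by rewrite /ofZ !rmorphM. Qed.

Lemma ofZ_nat n : ofZ n%:R = n%:R.
Proof. by rewrite /ofZ !rmorph_nat. Qed.

Lemma ofZ_sum (I : Type) (s : seq I) (F : I -> Z) :
  ofZ (\sum_(i <- s) F i) = \sum_(i <- s) ofZ (F i).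
Proof. by rewrite /ofZ !rmorph_sum. Qed.

Lemma ler_ofZ a b : (ofZ a <= ofZ b) = (a <= b).
Proof.
rewrite ler_int -subr_ge0 -[RHS]subr_ge0 -rmorphB.
by case: (b - a).
Qed.

Definition eval f L : R := \sum_(j <- labels) ofZ (L j) * f j.

Lemma eval_ge0 f L : {in labels, forall j, 0 <= f j} ->
  {in labels, forall j, 0 <= L j} -> 0 <= eval f L.
Proof.
move=> f0 L0; rewrite /eval big_seq sumr_ge0 // => j jl.
by rewrite mulr_ge0 ?f0 // -[0]/(ofZ 0) ler_ofZ L0.
Qed.

Lemma eq_eval f L M : {in labels, L =1 M} -> eval f L = eval f M.
Proof. by move=> LM; apply: eq_big_seq => j /LM ->. Qed.

Lemma evalD f L M : eval f (fun j => L j + M j) = eval f L + eval f M.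
Proof.
by rewrite /eval -big_split; apply: eq_bigr => j _; rewrite ofZD mulrDl.
Qed.

Lemma evalB f L M : eval f (fun j => L j - M j) = eval f L - eval f M.
Proof.
apply: (addIr (eval f M)); rewrite -evalD subrK.
by apply: eq_eval => j _; rewrite subrK.
Qed.

Lemma evalZ f c L : eval f (fun j => c * L j) = ofZ c * eval f L.
Proof.
by rewrite /eval mulr_sumr; apply: eq_bigr => j _; rewrite ofZM mulrA.
Qed.

Lemma eval_comb f cs Ls :
  eval f (comb cs Ls) = \sum_(p <- zip cs Ls) ofZ p.1 * eval f p.2.
Proof.
elim: cs Ls => [|c cs IHcs] [|L Ls]; rewrite ?big_nil ?big_cons;
  try by rewrite /eval big1 // => j _; rewrite mul0r.
by rewrite -IHcs -evalZ -evalD.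
Qed.

Lemma eval_comb1 f Ls :
  eval f (comb (nseq (size Ls) 1) Ls) = \sum_(L <- Ls) eval f L.
Proof.
rewrite eval_comb; elim: Ls => [|L Ls IHLs] /=; first by rewrite !big_nil.
by rewrite !big_cons IHLs mul1r.
Qed.

(** The constraints on one message [p_e(tau|.)], with [q] the common average. The total mass is left
    free: constraints and losses are homogeneous in [f] and [q]. *)
Definition feasible f q :=
  {in labels, forall j, 0 <= f j} /\
  {in Omega_labels, forall l, \sum_(j <- l) f j = (size l)%:R * q}.

Lemma feasible_ge0 f q : feasible f q -> 0 <= q.
Proof.
move=> [f0 fO]; have := fO [:: 1; 2; 3]%N isT.
rewrite !big_cons big_nil /=.
by have := f0 1%N isT; have := f0 2%N isT; have := f0 3%N isT; lra.
Qed.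

Lemma eval_indicator f l : uniq l -> {subset l <= labels} ->
  eval f (indicator l) = \sum_(j <- l) f j.
Proof.
move=> ul ll; rewrite /eval /indicator.
rewrite (eq_bigr (fun j => if j \in l then f j else 0)); last first.
  by move=> j _; case: ifP => _; rewrite ?mul1r ?mul0r.
rewrite -big_mkcond -big_filter; apply/perm_big/uniq_perm => //.
  exact/filter_uniq/iota_uniq.
by move=> j; rewrite mem_filter andb_idr // => /ll.
Qed.

Lemma eval_Omega f q l :
  feasible f q -> l \in Omega_labels -> eval f (indicator l) = (size l)%:R * q.
Proof.
move=> [_ fO] lO; rewrite -fO //.
have /allP/(_ l lO) /andP[ul /allP ll] :
    all (fun l => uniq l && all [in labels] l) Omega_labels by vm_compute.
exact: eval_indicator.
Qed.

Lemma eval_comb_Omega f q cs : feasible f q ->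
  eval f (comb cs (map indicator Omega_labels)) =
  ofZ (\sum_(p <- zip cs (map size Omega_labels)) p.1 * p.2%:R) * q.
Proof.
move=> ff; rewrite eval_comb ofZ_sum mulr_suml.
(* The evaluation rule is generalised along with the list, so that it is available for the members
   of each tail. *)
elim: Omega_labels {ff}(@eval_Omega f q ^~ ff) cs => [|l s IHs] Hs [|c cs] //=.
- by rewrite !big_nil.
- by rewrite !big_nil.
- by rewrite !big_nil.
rewrite !big_cons /= IHs => [|l' l's]; last by apply: Hs; rewrite inE l's orbT.
by rewrite Hs ?mem_head // ofZM ofZ_nat mulrA.
Qed.

(** * Losses and the soundness of branch-and-bound certificates *)

Definition loss f (y : nat) : R :=
  Num.min (eval f (piece false y)) (eval f (piece true y)).

Lemma piece_ge0 z y j : 0 <= piece z y j.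
Proof. by rewrite /piece /coef; do ![case: ifP => // _]. Qed.

Lemma loss_ge0 f q y : feasible f q -> 0 <= loss f y.
Proof.
by move=> [f0 _]; rewrite le_min !eval_ge0 // => j _; exact: piece_ge0.
Qed.

(* A leaf [Leaf D lam mu] is a dual solution with common denominator [D]: the
   multipliers [lam] belong to Omega_1, ..., Omega_18, the nonnegative [mu] to
   the inequalities assumed on the way to the leaf, latest first.  Missing
   trailing multipliers are zero. *)
Inductive cert : Type :=
  | Leaf of Z & seq Z & seq Z
  | Node of nat & cert & cert.

(* [acc] is the sum of the smaller terms chosen so far, [cons] the forms assumed
   nonnegative, [ys] the vertices not yet branched on, whose losses are bounded
   below by 0 at a leaf.  The target 457 (true minimum about 484) makes the loss
   457 / 105 exceed 58 * (1 - 0.925) = 4.35. *)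
Fixpoint check (acc : form) (cons : seq form) (ys : seq nat) (t : cert) : bool :=
  match t with
  | Leaf D lam mu =>
    [&& 0 < D, all (fun c => 0 <= c) mu,
        457 * D <=
          foldr (fun p r => p.1 * p.2%:R + r) 0 (zip lam (map size Omega_labels)) &
        all (fun j => comb lam (map indicator Omega_labels) j + comb mu cons j
                      <= D * acc j) labels]
  | Node y l r =>
    let a := piece false y in let b := piece true y in
    [&& y \in ys,
        check (fun j => acc j + a j) ((fun j => b j - a j) :: cons) (rem y ys) l &
        check (fun j => acc j + b j) ((fun j => a j - b j) :: cons) (rem y ys) r]
  end.

(** At a node, [loss f y] is the smaller term, which joins [acc], and the difference of the two
    terms, being nonnegative, joins [cons]. A leaf is weak duality: as [f] is nonnegative, the
    coefficientwise inequality passes to values; the [mu] part is nonnegative, the [lam] part is at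
    least [457 * D * q], and [D > 0] cancels. *)
Lemma check_sound f q t acc cons ys : feasible f q ->
  foldr (fun L P => 0 <= eval f L /\ P) True cons -> check acc cons ys t ->
  457 * q <= eval f acc + \sum_(y <- ys) loss f y.
Proof.
move=> ff; have [f_ge0 _] := ff.
elim: t acc cons ys => [D lam mu|y l IHl r IHr] acc cons ys Hcons; cbn [check].
  case/and4P=> D_gt0 mu_ge0 lamD /allP dual.
  have D0 : 0 < ofZ D :> R by rewrite ltNge -[0]/(ofZ 0) ler_ofZ -ltNge.
  apply: ler_wpDr; first by apply: sumr_ge0 => y _; exact: loss_ge0 ff.
  rewrite -(ler_pM2l D0) -evalZ -subr_ge0.
  have comb_ge0 : 0 <= eval f (comb mu cons).
    rewrite eval_comb; elim: cons mu mu_ge0 Hcons {dual} => [|L Ls IHLs] [|c cs] //=;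
      rewrite ?big_nil //.
    case/andP=> c0 cs0 [L0 Ls0]; rewrite big_cons addr_ge0 ?IHLs //.
    by rewrite mulr_ge0 // -[0]/(ofZ 0) ler_ofZ.
  have lam_ge : 457 * ofZ D * q <= eval f (comb lam (map indicator Omega_labels)).
    rewrite (eval_comb_Omega _ ff) ler_wpM2r ?(feasible_ge0 ff) //.
    (* Unlocking the big operator exposes the [foldr] that [check] computes. *)
    by rewrite -[457]ofZ_nat -ofZM ler_ofZ unlock.
  have : 0 <= eval f (fun j => D * acc j +
      -1 * (comb lam (map indicator Omega_labels) j + comb mu cons j)).
    by apply: eval_ge0 => // j jl; rewrite mulN1r subr_ge0 dual.
  rewrite evalD [in X in _ + X]evalZ evalD.
  have -> : ofZ (-1) = -1 :> R by [].
  by lra.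
case/and3P=> yys cl cr; rewrite (perm_big _ (perm_to_rem yys)) big_cons addrA.
rewrite [loss f y]/loss.
case: (leP (eval f (piece false y))) => [le_ab|/ltW le_ba].
  by rewrite -evalD; apply: IHl cl; split=> //; rewrite evalB subr_ge0.
by rewrite -evalD; apply: IHr cr; split=> //; rewrite evalB subr_ge0.
Qed.

End Eval.

(** * The certificate on the sorted chamber *)

(** These are the constraints present at the root, so their multipliers come after all branching
    multipliers in each [mu]. *)
Definition order_forms : seq form :=
  [seq (fun j => indicator [:: i.+1] j - indicator [:: i] j) | i <- [:: 10; 11; 12]%N].

Section Certificate.
Local Open Scope Z_scope.
(* Found by floating-point branch and bound, then rounded to integers. *)
Definition certificate : cert :=
  Node 12 (Node 11 (Node 10 (Node 18 (Node 9 (Node 4 (Node 5 (Node 6 (Node 7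
  (Node 1 (Node 2 (Node 25 (Leaf 6 [:: 204; -5; 48; -214; 0; 0; 0; -91; 245;
  -57; 0; 0; -52; 0; 0; 175; 305; 52] [:: 0; 0; 0; 0; 0; 0; 1; 0; 1]) (Leaf 1
  [:: 42; 0; 0; -60; 0; 0; 0; -25; 35; 0; -25; -25; 0; -25; 0; 0; 85; 50]
  [::])) (Node 13 (Leaf 7 [:: 0; 375; 0; -3; 0; 0; 0; -76; 210; -168; -114; 0;
  0; -35; -76; 0; 153; 496] [:: 0; 0; 0; 0; 0; 0; 0; 0; 0; 0; 0; 1; 0; 0; 38])
  (Leaf 12 [:: -1440; 2404; 1440; 25; 0; 0; 0; -25; 809; -1589; -1026; 420;
  -114; 0; 0; -35; 0; 720] [:: 0; 0; 0; 0; 0; 0; 1; 0; 12]))) (Node 13 (Leaf 7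
  [:: -87; 87; 375; -3; 0; 0; 0; -76; 210; -35; 0; -114; 0; -168; -76; 0; 153;
  496] [:: 0; 0; 0; 0; 0; 0; 0; 0; 0; 0; 1; 0; 0; 38]) (Node 25 (Leaf 4 [:: 0;
  0; 162; 0; 0; -2; -5; -82; 175; 0; 0; 0; 0; -2; 0; 207; 82] [:: 2; 0; 0; 0;
  0; 0; 0; 0; 1]) (Leaf 7 [:: -1189; 1189; 1450; 0; 0; -12; 0; 0; 455; 0; 71;
  -649; 0; -1018; 0; 0; 0; 578] [:: 0; 0; 0; 0; 0; 0; 0; 0; 6; 0; 0; 0;
  166])))) (Leaf 5 [:: 0; 0; 240; -3; 0; 0; 0; 0; 3; 0; 0; -600; 0; 0; -297;
  0; 300; 625] [:: 1; 0; 0; 0; 0; 0; 0; 0; 0; 28; 0; 328])) (Node 13 (Node 8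
  (Leaf 1 [:: 0; 0; 0; 0; 0; 0; 0; 0; 35; 0; -13; -6; -8; -30; 0; 0; 30; 87]
  [:: 0; 0; 0; 0; 0; 0; 0; 0; 0; 0; 0; 27]) (Leaf 4 [:: 0; 0; 10; 0; 0; 0; 0;
  -100; 130; 0; -76; -72; -72; -170; 0; 0; 100; 580] [:: 0; 2; 1])) (Node 8
  (Leaf 1 [:: 42; -42; 0; -42; 0; 2; 0; 0; 70; 0; 0; 0; -75; -104; 0; 0; 102;
  75] [:: 0; 0; 0; 0; 0; 0; 1; 0; 0; 0; 0; 15]) (Node 1 (Leaf 6 [:: 378; 0;
  210; -263; 0; 595; 0; 0; 980; 0; 210; 210; -1140; -1640; 91; 0; 172; 720]
  [:: 3; 0; 0; 11; 0; 0; 0; 22]) (Leaf 16 [:: -1920; 1920; 3416; -624; 0; 695;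
  0; 64; 2065; 0; 560; -1275; -1141; -4351; 560; 0; 0; 1856] [:: 0; 0; 0; 4;
  0; 0; 0; 43]))))) (Leaf 8 [:: 0; 752; 0; 0; 443; 0; 0; 0; 350; 0; -1855; 0;
  0; 0; 0; 0; 0; 1149] [:: 11; 0; 0; 2; 0; 0; 0; 0; 669; 1819])) (Node 13
  (Node 16 (Leaf 3 [:: 0; 112; 0; 0; 0; 0; 73; 0; 120; -112; 0; -73; 0; 0; 0;
  0; 0; 253] [:: 0; 0; 0; 0; 1; 0; 0; 0; 73; 39]) (Leaf 6 [:: 222; -7; -222;
  -222; 0; 0; 0; 0; 245; -275; -103; -82; -82; 0; 0; 0; 222; 747] [:: 0; 2; 1;
  0; 1; 0; 0; 0; 387])) (Node 1 (Node 6 (Node 8 (Leaf 1 [:: 0; 30; 0; 0; 0; 0;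
  0; 0; 70; -90; 0; 0; -75; 0; 0; 0; 60; 75] [:: 0; 0; 0; 0; 0; 0; 1; 0; 0; 0;
  15]) (Node 2 (Leaf 8 [:: 462; 168; 0; -280; 0; 0; 0; 0; 805; -933; 0; 0;
  -308; 0; 0; 350; 280; 308] [:: 3; 0; 0; 0; 0; 2; 0; 15]) (Leaf 2 [:: 0; 252;
  0; -325; 0; 0; 0; 70; 245; -507; -198; 55; -52; 0; 70; 70; 185; 195] [:: 0;
  0; 0; 0; 0; 0; 0; 5; 0; 0; 0; 25]))) (Leaf 5 [:: 210; 210; 0; -210; 0; 155;
  0; 0; 615; -575; 175; 175; -795; -365; 0; 155; 210; 445] [:: 0; 0; 0; 0; 0;
  13])) (Leaf 1 [:: 84; 0; 0; -1; 0; 0; 0; 0; 70; 0; 0; 0; -9; 0; 0; 0; 0; 9]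
  [:: 1; 0; 2; 0; 1])))) (Leaf 11 [:: 1870; -1870; -1870; -28; 0; 0; 0; 0;
  -3752; 0; 0; 0; -130; 0; 0; 0; 1870; 2801] [:: 34; 0; 0; 0; 0; 2141; 4282]))
  (Node 16 (Node 7 (Node 13 (Node 22 (Node 21 (Node 14 (Leaf 9 [:: 0; -6; -6;
  0; 315; 0; 315; 0; 0; 0; -369; 171; 280; 0; 0; 0; 0; 510] [:: 0; 0; 0; 1; 0;
  0; 0; 0; 0; 0; 285; 570]) (Node 8 (Leaf 7 [:: -225; 222; -6; 225; 0; 0; 245;
  0; -105; -320; -140; -157; 105; -92; 0; 0; 98; 840] [:: 0; 0; 0; 0; 4; 0; 0;
  3; 0; 0; 0; 0; 665]) (Leaf 3 [:: 0; 0; -36; 112; 0; 0; 86; -112; 0; 0; -70;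
  10; 0; 0; 0; 0; 0; 360] [:: 0; 0; 0; 0; 2]))) (Leaf 4 [:: 0; 0; 0; 0; 0; 0;
  134; -4; 0; 0; 0; 0; 175; 0; 0; -4; 0; 240] [:: 0; 1; 0; 0; 0; 0; 0; 0; 0;
  0; 126])) (Node 21 (Leaf 1 [:: 0; 0; 0; 0; -4; -2; 25; 0; 0; 0; 0; 35; 0; 0;
  -2; 0; 0; 77] [:: 0; 0; 0; 0; 0; 0; 0; 0; 0; 9; 51; 8]) (Leaf 2 [:: 0; 0; 0;
  0; -25; -25; 102; 0; 0; 0; 0; 0; 0; 0; -25; -25; 25; 194] [:: 0; 0; 0; 0; 1;
  0; 0; 0; 0; 0; 211; 166]))) (Node 4 (Node 6 (Node 8 (Leaf 1 [:: 0; 0; 0; 0;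
  0; 0; 35; 0; 0; 0; 0; 0; 0; 0; 0; 0; 60] [::]) (Leaf 1 [:: 0; 0; 0; 0; 0; 0;
  70; -60; 0; 0; 0; -75; 0; 0; 0; 0; 60; 75] [:: 0; 0; 0; 0; 0; 1; 0; 0; 0; 0;
  0; 30])) (Node 8 (Leaf 3 [:: -180; 180; 0; 180; 0; 0; 275; 0; 0; 0; 0; -35;
  0; 0; 0; 0; 0; 35] [:: 0; 0; 0; 0; 0; 5; 0; 0; 0; 0; 0; 430]) (Leaf 9 [:: 0;
  0; -16; 372; 0; 130; 1040; -1305; -1; 0; 0; -1204; 0; -654; 333; 0; 540;
  1204] [:: 1; 0; 0; 0; 0; 21; 0; 0; 0; 0; 0; 1071]))) (Node 8 (Node 6 (Leaf 1
  [:: 0; 42; 0; 0; 0; 0; 70; 0; 0; 2; 0; -75; 0; 0; 0; -104; 60; 75] [:: 0; 0;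
  0; 0; 0; 1; 0; 0; 0; 0; 15]) (Leaf 9 [:: 0; 372; -16; 0; 0; -124; 1040; 0;
  0; 333; 0; -1204; 0; -400; 0; -1305; 540; 1204] [:: 0; 0; 1; 0; 0; 21; 0; 0;
  0; 0; 0; 1071])) (Leaf 2 [:: 0; 84; 0; 84; 0; 0; 245; -154; 0; 70; 70; -319;
  59; 0; 70; -154; 0; 190] [:: 0; 0; 0; 0; 5; 0; 0; 0; 0; 20; 100])))) (Leaf 3
  [:: 330; -330; -9; -330; 0; 0; 0; 0; 0; 0; 0; -621; 0; 0; 0; 0; 330; 571]
  [:: 5; 0; 0; 0; 0; 0; 391; 311; 522])) (Node 14 (Node 13 (Node 5 (Node 8
  (Node 4 (Leaf 3 [:: 0; 0; 0; 0; 12; -143; 0; 0; 0; 0; -35; -35; -35; 0; 0;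
  0; 143; 311] [:: 0; 0; 0; 1]) (Leaf 5 [:: -246; 0; 246; 246; 136; -246; 0;
  0; 0; 0; -85; -75; -75; 0; 0; 0; 0; 655] [:: 0; 0; 0; 2; 0; 0; 0; 0; 0; 0;
  245])) (Leaf 3 [:: 0; 0; 0; 105; 105; 0; 0; 0; 0; 0; -44; -38; -38; 0; -105;
  0; 0; 360] [:: 0; 0; 1])) (Leaf 1 [:: 0; 0; 0; 0; 0; 0; 0; 0; 0; 0; 0; 0; 0;
  0; 0; 0; 0; 120] [::])) (Node 5 (Node 4 (Node 6 (Leaf 1 [:: 0; 0; 0; 0; 70;
  0; -1; 0; 0; 0; -75; 0; 0; 0; -60; 0; 60; 75] [:: 0; 0; 0; 0; 1; 0; 0; 0; 0;
  0; 90; 44]) (Node 8 (Leaf 1 [:: 0; 0; 30; 0; 70; -90; 0; 0; 0; 0; -75; 0; 0;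
  0; 0; 0; 60; 75] [:: 0; 0; 0; 0; 0; 1]) (Leaf 1 [:: 0; -1; 42; 0; 101; -122;
  0; 0; 0; 0; -160; 0; 0; 20; -60; 0; 60; 160] [:: 0; 0; 0; 0; 0; 2; 0; 0; 0;
  0; 0; 19]))) (Node 8 (Leaf 4 [:: -240; -280; 240; 240; 590; -240; 0; 0; 0;
  140; -370; 140; 140; 0; 0; 140; 0; 90] [:: 0; 0; 0; 0; 13; 0; 0; 0; 0; 0;
  980; 490]) (Leaf 6 [:: 0; -7; 0; 258; 766; 0; 0; 233; 0; 0; -639; 0; 0; 0;
  -551; 7; 0; 639] [:: 1; 0; 0; 0; 16; 0; 0; 0; 0; 0; 1048; 441]))) (Leaf 1
  [:: 0; 0; 0; 0; 0; 0; 0; 0; 0; 0; 0; 2; 0; 0; 0; 0; 0; 118] [:: 1]))) (Node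
  6 (Node 4 (Node 1 (Node 2 (Node 15 (Node 8 (Leaf 4 [:: 98; 3; -14; -127;
  -70; 70; 0; 0; 0; -35; -22; -233; 0; -70; 0; -35; 367; 255] [:: 0; 0; 0; 0;
  1; 2; 2]) (Leaf 1 [:: 42; 0; 0; 0; 0; 35; 0; -50; 0; 0; 0; 0; -155; -35;
  -10; 0; 60; 155] [::])) (Leaf 9 [:: 121; -7; 467; -341; 0; -140; 0; -314;
  -3; -35; -168; -890; 0; 0; 0; -35; 655; 1058] [:: 4; 5; 0; 1])) (Node 23
  (Leaf 4 [:: -302; 554; 294; 0; 0; 0; -4; -46; -35; -170; -480; 0; 0; 140; 0;
  -70; 46; 480] [:: 0; 0; 0; 2; 0; 0; 0; 1]) (Leaf 6 [:: 0; 292; 0; -360; -35;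
  0; 0; -360; 0; -176; -896; 0; 0; 0; 0; -176; 720; 896] [:: 0; 0; 0; 5; 0; 1;
  0; 0; 0; 0; 0; 117; 59]))) (Node 19 (Node 25 (Leaf 6 [:: -137; 11; 473; 0;
  0; -35; 0; 0; 0; 315; 0; -173; 0; -35; 0; 274; 0; 173] [:: 2; 3; 3; 0; 1])
  (Leaf 6 [:: -533; 533; 596; 0; 0; -148; 0; 0; -197; 210; -114; -801; 0;
  -148; -300; 0; 300; 915] [:: 0; 0; 0; 0; 4; 0; 0; 5])) (Node 8 (Leaf 3 [::
  0; 0; -2; 4; 0; -35; 0; -35; -70; 0; 0; -184; 0; -35; -35; 0; 306; 184] [::
  1; 0; 0; 0; 1; 0; 0; 2]) (Leaf 3 [:: -420; 420; 456; 0; 0; -78; 0; 0; 0; 0;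
  -60; -424; 0; -78; 0; 0; 0; 484] [:: 0; 0; 0; 0; 2])))) (Node 8 (Node 2
  (Node 3 (Leaf 1 [:: 42; 0; 0; 0; 0; 0; 0; 0; 0; -32; -164; 0; 0; 0; 0; -28;
  60; 164] [:: 0; 0; 0; 0; 0; 0; 0; 0; 0; 0; 0; 44]) (Leaf 6 [:: 0; -655; 292;
  0; 0; -176; -35; 0; 0; 0; 0; -898; 0; -176; 0; -65; 720; 898] [:: 0; 0; 0;
  0; 5; 0; 1; 0; 0; 0; 0; 304])) (Leaf 6 [:: -364; 0; 280; 484; 0; 0; 0; -192;
  0; 0; 0; 0; -1043; 0; -192; -560; 560; 1043] [:: 2; 5; 0; 0; 0; 0; 0; 0; 0;
  0; 460])) (Node 2 (Node 15 (Node 23 (Leaf 1 [:: 42; 0; -2; -3; 0; 35; 0; 11;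
  -4; 5; -144; 0; 0; 35; 0; 3; -8; 144] [::]) (Leaf 5 [:: 119; 0; 175; 0; 0;
  210; 0; 0; 0; 0; -794; 0; 0; 0; 0; 0; 0; 794] [:: 0; 1; 2; 0; 0; 0; 0; 0; 0;
  0; 0; 0; 194])) (Node 23 (Leaf 5 [:: 167; 1; 127; -48; 0; 0; 0; 0; 0; -319;
  -999; 0; 0; 210; 0; 210; 48; 999] [:: 1; 0; 2; 0; 1]) (Leaf 6 [:: -210; 0;
  911; 0; 0; -191; 0; 0; 0; 0; 0; -1238; 0; 0; 0; 0; 0; 1238] [:: 0; 5; 11])))
  (Node 15 (Node 23 (Leaf 3 [:: 357; -105; -357; -105; 0; 210; 0; 105; 0; 0;
  -220; 0; 0; 175; 0; 105; 0; 220] [:: 2; 3; 0; 0; 0; 0; 0; 0; 0; 0; 0; 0;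
  76]) (Leaf 3 [:: 357; -105; -357; -105; 0; 385; -1; 105; 0; 105; -220; 0; 0;
  0; 0; 0; 0; 220] [:: 0; 8; 0; 0; 0; 0; 0; 0; 0; 0; 0; 0; 577; 181])) (Node
  23 (Leaf 2 [:: 0; 168; 0; 160; 0; 0; 0; -211; 0; -430; -508; 0; -113; 105;
  -141; 70; 192; 621] [:: 1]) (Node 13 (Leaf 1 [:: 0; 0; 0; 0; 0; 0; 0; 0; 0;
  0; -35; -35; -35; 0; 0; 0; 0; 225] [:: 1]) (Node 3 (Leaf 1 [:: 0; 84; 0;
  126; 0; 0; 0; -136; 0; -230; -224; -60; -186; 0; -230; -94; 240; 470] [::])
  (Leaf 2 [:: 294; 0; 42] [:: 7; 0; 0; 0; 1; 9])))))))) (Node 2 (Node 8 (Node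
  4 (Node 1 (Node 3 (Leaf 1 [:: 42; 0; -32; 0; 0; 0; 0; 0; 0; 0; 0; 0; -164;
  -28; 0; 0; 60; 164] [:: 0; 0; 0; 0; 0; 0; 0; 0; 0; 0; 0; 0; 0; 44]) (Leaf 4
  [:: 0; 197; -295; 0; 0; 0; 0; 0; 0; -110; -596; 0; 0; -148; 0; -110; 443;
  596] [:: 0; 0; 3; 0; 0; 0; 0; 0; 0; 0; 0; 0; 0; 194])) (Leaf 6 [:: -402;
  318; 0; 522; 0; 0; 0; -192; -1; 0; 0; 0; -1043; -522; -192; 0; 522; 1043]
  [:: 2; 0; 5; 0; 0; 0; 0; 0; 0; 0; 0; 100; 560])) (Node 3 (Node 17 (Leaf 3
  [:: 208; -166; -40; -1; 0; 73; 0; 105; 0; 105; -467; 0; 0; 11; 0; 105; -44;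
  467] [:: 0; 2; 0; 0; 0; 0; 0; 0; 0; 0; 0; 0; 0; 137]) (Leaf 3 [:: 26; -207;
  -81; 394; 0; 105; 0; -175; -1; 102; 0; 0; -643; -24; 0; 105; 0; 643] [:: 5;
  7; 0; 0; 0; 0; 0; 0; 0; 0; 0; 0; 208])) (Node 24 (Node 17 (Leaf 8 [:: 1232;
  -560; -224; -1232; -6; -56; 0; 525; 0; 280; -276; 0; 0; 280; 626; 280; 0;
  276] [:: 7; 10; 0; 0; 0; 0; 0; 0; 0; 0; 0; 0; 0; 0; 88]) (Leaf 8 [:: 1011;
  -280; 56; -1095; -11; -336; 0; 0; 0; 280; -529; 0; 0; 280; 1149; 0; 0; 529]
  [:: 0; 25; 2; 0; 0; 0; 0; 0; 0; 0; 0; 0; 0; 1391])) (Node 17 (Leaf 2 [::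
  191; -23; 61; -191; 0; 70; 0; 245; 0; -47; -198; 0; 0; -131; 0; 70; 0; 198]
  [:: 5; 0; 0; 0; 0; 0; 0; 0; 0; 0; 0; 0; 0; 0; 459]) (Node 13 (Leaf 1 [:: 0;
  0; 0; 0; 0; 0; 0; 0; 0; 0; -35; -35; -35; 0; 0; 0; 0; 225] [:: 1]) (Leaf 1
  [:: 84; 0; 42; -84; 0; -230; 0; 0; 0; -94; -224; -186; -60; -136; 0; -230;
  324; 470] [::])))))) (Node 4 (Node 1 (Node 25 (Leaf 2 [:: 137; -11; -13;
  -97; 0; 70; 0; 27; 0; 0; -340; 0; 0; -57; 70; 70; 0; 340] [:: 0; 1; 0; 0; 0;
  0; 0; 0; 0; 0; 0; 0; 0; 77]) (Leaf 5 [:: 224; 314; -140; -350; 0; 175; 0;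
  175; 0; 0; -501; -434; 0; -35; 175; -74; 0; 935] [:: 2; 8; 0; 0; 0; 0; 0; 0;
  0; 0; 0; 0; 85])) (Node 25 (Node 19 (Leaf 4 [:: 560; -560; -56; -224; 0;
  140; 0; 84; -7; 311; -200; 0; 0; -84; 140; 245; 0; 200] [:: 5; 3]) (Leaf 1
  [:: 140; -140; -14; -56; 0; 35; 0; 21; 0; 0; -50; 0; 0; -21; 35; 140; 0; 50]
  [:: 0; 3; 0; 0; 0; 0; 0; 0; 0; 0; 0; 0; 0; 0; 211])) (Node 19 (Leaf 1 [:: 0;
  0; 126; 24; 0; 35; 0; -19; 0; 70; -204; -55; 0; -210; -54; 0; 49; 259] [::
  1]) (Node 13 (Leaf 1 [:: 0; 0; 0; 0; 0; 0; 0; 0; 0; 0; -35; -35; -35; 0; 0;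
  0; 0; 225] [:: 1]) (Leaf 1 [:: 0; 0; 126; 84; 0; -136; 0; -230; 0; 0; -140;
  -186; -144; -230; -94; 0; 240; 470] [::]))))) (Leaf 14 [:: 1666; -1080;
  -490; -1080; 0; 490; 0; 510; 0; 510; -1787; 0; 0; 0; 510; 510; 0; 1787] [::
  1; 1]))) (Leaf 3 [:: 773; 0; -311; 0; 0; 11] [:: 16; 24])))))) (Leaf 2 [::
  0; 0; 0; 0; 245; 245; 0; 0; 0; 0; 0; 0; 0; 0; 33; 0; 0; -146] [:: 5; 0; 0;
  677; 411; 146])) (Leaf 1 [:: 0; 0; 0; 0; 0; 0; 280; 280; -1; 0; 0; 0; 0; 0;
  0; 59; 0; -326] [:: 7; 0; 0; 713; 326])) (Leaf 1 [:: 0; 0; 0; -875; 0; 0; 0;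
  0; 1224; 1225; -875; -875; 0; 1225; 0; 0; 875; -1982] [:: 34; 1982; 0;
  3732]).
End Certificate.

(** The numerical origin of the multipliers is harmless: every leaf inequality is tested exactly in
    [Z]. *)
Lemma certificate_valid : check (fun=> 0) order_forms labels certificate.
Proof. by vm_compute. Qed.

(** * Reduction to the sorted chamber by symmetry *)

Section Symmetry.
Context {R : realType}.
Implicit Types (f : nat -> R) (q : R).

Lemma loss_sorted f q : feasible f q ->
  f 10%N <= f 11%N -> f 11%N <= f 12%N -> f 12%N <= f 13%N ->
  457 * q <= \sum_(y <- labels) loss f y.
Proof.
move=> ff le10 le11 le12.
have -> : \sum_(y <- labels) loss f y =
    eval f (fun=> 0) + \sum_(y <- labels) loss f y.
  by rewrite /eval [X in X + _]big1 ?add0r // => j _; rewrite mul0r.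
apply: (check_sound ff _ certificate_valid).
have eval_diff i k : i \in labels -> k \in labels -> f i <= f k ->
    0 <= eval f (fun j => indicator [:: k] j - indicator [:: i] j).
  move=> il kl le_ik; rewrite evalB !eval_indicator ?big_seq1 ?subr_ge0 //.
    by move=> j; rewrite inE => /eqP ->.
  by move=> j; rewrite inE => /eqP ->.
by do !split; apply: eval_diff.
Qed.

Definition relabel (s : seq nat) (j : nat) : nat := nth 0%N s j.

(** The last condition is the equivariance of the pieces under relabelling both vertex and variable,
    rewritten with one [relabel] on each side because [relabel s] is an involution. *)
Definition automorphism (s : seq nat) : bool :=
  [&& perm_eq (map (relabel s) labels) labels,
      all (fun j => relabel s (relabel s j) == j) labels,
      all (fun l => has (perm_eq (map (relabel s) l)) Omega_labels) Omega_labels &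
      all (fun y => all (fun j =>
        (piece false y (relabel s j) == piece false (relabel s y) j) &&
        (piece true y (relabel s j) == piece true (relabel s y) j)) labels) labels].

Lemma feasible_relabel s f q :
  automorphism s -> feasible f q -> feasible (f \o relabel s) q.
Proof.
case/and4P=> sl _ /allP sO _ [f0 fO]; split=> [j jl|l lO].
  by apply: f0; rewrite -(perm_mem sl) map_f.
have /hasP[l' l'O sll'] := sO _ lO.
rewrite -(size_map (relabel s)) (perm_size sll') -fO // -(perm_big _ sll').
by rewrite big_map.
Qed.

(** By equivariance, the loss of the relabelled point at [y] is the loss of [f] at [relabel s y], so
    the two sums differ by a reindexing. *)
Lemma sum_loss_relabel s f : automorphism s ->
  \sum_(y <- labels) loss (f \o relabel s) y = \sum_(y <- labels) loss f y.
Proof.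
case/and4P=> sl /allP sK _ /allP sp.
have eval_relabel L : eval (f \o relabel s) L = eval f (L \o relabel s).
  rewrite /eval -(perm_big _ sl) big_map; apply: eq_big_seq => j /sK /eqP /= ->.
  by [].
rewrite -[RHS](perm_big _ sl) big_map; apply: eq_big_seq => y /sp /allP spy.
by rewrite /loss !eval_relabel; congr Num.min;
  apply: eq_eval => j /spy /andP[/eqP ? /eqP ?].
Qed.

(* The involutions of the configuration exchanging 10 and 11, 11 and 12, and 12
   and 13; position 0 is a dummy. *)
Definition swap10 : seq nat :=
  [:: 0; 2; 1; 3; 6; 7; 4; 5; 8; 9; 11; 10; 12; 13;
      16; 25; 14; 24; 18; 23; 21; 20; 22; 19; 17; 15]%N.
Definition swap11 : seq nat :=
  [:: 0; 1; 3; 2; 4; 5; 8; 9; 6; 7; 10; 12; 11; 13;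
      14; 24; 18; 23; 16; 25; 20; 22; 21; 17; 15; 19]%N.
Definition swap12 : seq nat :=
  [:: 0; 2; 1; 3; 7; 6; 5; 4; 8; 9; 10; 11; 13; 12;
      15; 14; 25; 17; 22; 21; 23; 19; 18; 20; 24; 16]%N.

Lemma automorphism_swap10 : automorphism swap10.
Proof. by vm_compute. Qed.

Lemma automorphism_swap11 : automorphism swap11.
Proof. by vm_compute. Qed.

Lemma automorphism_swap12 : automorphism swap12.
Proof. by vm_compute. Qed.

(** Bubble sort of [f 10, ..., f 13] by three adjacent swaps that preserve feasibility and total
    loss. The claims go from the last comparisons back to the first: [max2] and [max3] carry the
    maximum to 13, [sort4] and [sort3] order the other three values. *)
Lemma loss_lower_bound f q : feasible f q ->
  457 * q <= \sum_(y <- labels) loss f y.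
Proof.
have swap s g : automorphism s -> feasible g q ->
    (feasible (g \o relabel s) q ->
     457 * q <= \sum_(y <- labels) loss (g \o relabel s) y) ->
    457 * q <= \sum_(y <- labels) loss g y.
  by move=> As fg; rewrite sum_loss_relabel //; apply; apply: feasible_relabel.
have sort3 g : feasible g q -> g 10%N <= g 11%N ->
    g 11%N <= g 13%N -> g 12%N <= g 13%N ->
    457 * q <= \sum_(y <- labels) loss g y.
  move=> fg le_ab le_bd le_cd.
  have [le_bc|/ltW le_cb] := leP (g 11%N) (g 12%N); first exact: loss_sorted fg _ _ _.
  apply: (swap _ _ automorphism_swap11) => // fg'.
  have [le_ac|/ltW le_ca] := leP (g 10%N) (g 12%N); first exact: loss_sorted fg' _ _ _.
  by apply: (swap _ _ automorphism_swap10) => // fg''; apply: loss_sorted fg'' _ _ _.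
have sort4 g : feasible g q -> g 10%N <= g 13%N ->
    g 11%N <= g 13%N -> g 12%N <= g 13%N ->
    457 * q <= \sum_(y <- labels) loss g y.
  move=> fg le_ad le_bd le_cd.
  have [le_ab|/ltW le_ba] := leP (g 10%N) (g 11%N); first exact: sort3.
  by apply: (swap _ _ automorphism_swap10) => // fg'; apply: sort3.
have max3 g : feasible g q -> g 10%N <= g 12%N -> g 11%N <= g 12%N ->
    457 * q <= \sum_(y <- labels) loss g y.
  move=> fg le_ac le_bc.
  have [le_cd|/ltW le_dc] := leP (g 12%N) (g 13%N).
    by apply: sort4 => //; [exact: le_trans le_ac _|exact: le_trans le_bc _].
  by apply: (swap _ _ automorphism_swap12) => // fg'; apply: sort4.
have max2 g : feasible g q -> g 10%N <= g 11%N ->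
    457 * q <= \sum_(y <- labels) loss g y.
  move=> fg le_ab; have [le_bc|/ltW le_cb] := leP (g 11%N) (g 12%N).
    by apply: max3 => //; exact: le_trans le_ab _.
  by apply: (swap _ _ automorphism_swap11) => // fg'; apply: max3.
move=> ff; have [le_ab|/ltW le_ba] := leP (f 10%N) (f 11%N); first exact: max2.
by apply: (swap _ _ automorphism_swap10) => // ff'; apply: max2.
Qed.

End Symmetry.

(** * Translation of the game into labels and linear forms *)

Lemma adj_label_sym j k : adj_label j k = adj_label k j.
Proof.
by rewrite /adj_label eq_sym; congr (_ && _); apply: eq_has => l; rewrite andbC.
Qed.

Lemma adj_labelE (x y : vertex) : adj x y = adj_label x.+1 y.+1.
Proof.
rewrite /adj /adj_label eqSS; congr (_ && _).
apply/existsP/hasP => [[w /and3P[w16]]|[l /(nthP [::])[w w16 <-]]].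
  rewrite !inE => xw yw; exists (nth [::] Omega_labels w); last by rewrite xw.
  by rewrite -(nth_take [::] w16) mem_nth.
rewrite size_take /= in w16; rewrite nth_take // => /andP[xw yw].
by exists (inord w); rewrite !inE inordK ?w16 ?xw ?(ltn_trans w16).
Qed.

Section Game.
Context {R : realType}.

Definition vert (j : nat) : vertex := inord j.-1.

Lemma succ_vertK (x : vertex) : vert x.+1 = x.
Proof. exact: inord_val. Qed.

Lemma succ_labels (x : vertex) : x.+1 \in labels.
Proof. by rewrite mem_iota /= ltnS ltn_ord. Qed.

Lemma mem_Omega_labels (w : 'I_18) : nth [::] Omega_labels w \in Omega_labels.
Proof. exact/mem_nth/(ltn_ord w). Qed.

Lemma sum_vertex (V : nmodType) (P : pred nat) (F : nat -> V) :
  \sum_(x : vertex | P x.+1) F x.+1 = \sum_(j <- labels | P j) F j.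
Proof.
have -> : labels = map S (index_iota 0 25) by [].
by rewrite big_map big_mkord.
Qed.

Lemma sum_Omega (V : nmodType) (w : 'I_18) (F : nat -> V) :
  \sum_(x in Omega w) F x.+1 = \sum_(j <- nth [::] Omega_labels w) F j.
Proof.
rewrite (eq_bigl (fun x : vertex => x.+1 \in nth [::] Omega_labels w)); last first.
  by move=> x; rewrite inE.
have /allP/(_ _ (mem_Omega_labels w)) /andP[ul /allP ll] :
    all (fun l => uniq l && all [in labels] l) Omega_labels by vm_compute.
rewrite (sum_vertex (fun j => j \in nth [::] Omega_labels w)).
rewrite -big_filter; apply/perm_big/uniq_perm => //.
  exact/filter_uniq/iota_uniq.
by move=> j; rewrite mem_filter andb_idr // => /ll.
Qed.

Lemma card_Omega (w : 'I_18) : #|Omega w| = size (nth [::] Omega_labels w).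
Proof. by rewrite -sum1_card (sum_Omega w (fun=> 1%N)) sum1_size. Qed.

Lemma card_nbrs (x : vertex) : #|nbrs x| = count (adj_label x.+1) labels.
Proof.
rewrite -sum1_card -sum1_count -sum_vertex; apply: eq_bigl => y.
by rewrite inE adj_labelE.
Qed.

Lemma multE (x : vertex) : mult x = count (fun l => x.+1 \in l) Omega_labels.
Proof.
rewrite /mult -sum1_card -sum1_count (big_nth [::]) big_mkord.
by apply: eq_bigl => w; rewrite !inE.
Qed.

(** The factor 105 is the least common multiple of the denominators 5, 7 and 3 of the weights. *)
Lemma weightE (x : vertex) : weight R x = ofZ (coef x.+1) / 105.
Proof.
have /allP H : all (fun j => (count (fun l => j \in l) Omega_labels)%:R * 105 ==
    coef j * (count (adj_label j) labels).+1%:R) labels by vm_compute.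
have /(congr1 (@ofZ R)) := eqP (H _ (succ_labels x)).
rewrite /weight card_nbrs multE !ofZM !ofZ_nat => E.
by apply/eqP; rewrite eqr_div ?pnatr_eq0 // E mulrC.
Qed.

(** The double sum is regrouped by message and by Bob's vertex instead of Alice's, which uses the
    symmetry of adjacency. The denominator is [58 * 105]. *)
Lemma figure_of_meritE L (pe : 'I_L -> vertex -> R) (pd : bool -> vertex -> 'I_L -> R) :
  figure_of_merit (observed pe pd) =
  6090^-1 * \sum_tau \sum_(j <- labels)
    (pd false (vert j) tau * eval (pe tau \o vert) (piece false j) +
     pd true (vert j) tau * eval (pe tau \o vert) (piece true j)).
Proof.
have -> : 6090 = 58 * 105 :> R by rewrite -natrM.
rewrite invfM -mulrA; congr (_ * _); rewrite mulr_sumr.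
(* [F] groups the terms by Alice's vertex; [G] below groups them by Bob's answer and the message. *)
pose F j := 105^-1 * ofZ (coef j) * (\sum_tau pe tau (vert j) * pd false (vert j) tau +
  \sum_(k <- labels | adj_label j k) \sum_tau pe tau (vert j) * pd true (vert k) tau) : R.
transitivity (\sum_(j <- labels) F j).
  rewrite -(sum_vertex xpredT); apply: eq_bigr => x _.
  rewrite /F weightE [_ / _]mulrC succ_vertK -(sum_vertex (adj_label x.+1)).
  congr (_ * (_ + _)); apply: eq_big => y; first by rewrite inE adj_labelE.
  by rewrite succ_vertK.
pose G z tau := \sum_(j <- labels)
  105^-1 * (pd z (vert j) tau * eval (pe tau \o vert) (piece z j)).
transitivity (\sum_tau G false tau + \sum_tau G true tau); last first.
  rewrite -big_split; apply: eq_bigr => tau _.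
  by rewrite /G /= -!mulr_sumr -mulrDr -big_split.
under eq_bigr do rewrite /F mulrDr.
rewrite big_split /G /=; congr (_ + _).
  rewrite [RHS]exchange_big; apply: eq_big_seq => j jl.
  rewrite mulr_sumr; apply: eq_bigr => tau _.
  rewrite /eval (bigD1_seq j) ?iota_uniq //= big1 => [|k /negPf kj].
    by rewrite /piece eqxx; ring.
  by rewrite /piece eq_sym kj mul0r.
rewrite [RHS]exchange_big /=.
transitivity (\sum_(j <- labels) \sum_(k <- labels | adj_label j k) \sum_tau
  105^-1 * ofZ (coef j) * (pe tau (vert j) * pd true (vert k) tau)).
  by apply: eq_bigr => j _; rewrite mulr_sumr; apply: eq_bigr => k _; rewrite mulr_sumr.
rewrite (exchange_big_dep xpredT) //=; apply: eq_bigr => k _; rewrite big_mkcond.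
under [RHS]eq_bigr do rewrite /eval 2!mulr_sumr.
rewrite [RHS]exchange_big /=; apply: eq_bigr => j _.
rewrite /piece adj_label_sym; case: ifP => _.
  by apply: eq_bigr => tau _; ring.
by rewrite big1 // => tau _; rewrite mul0r !mulr0.
Qed.

(** * Upper bound for every strategy *)

(** Here [5633 = 6090 - 457]: message [tau] offers [6090 * q tau] in total and loses at least
    [457 * q tau]. *)
Lemma figure_of_merit_le L (pe : 'I_L -> vertex -> R) (pd : bool -> vertex -> 'I_L -> R) :
  oblivious_strategy pe pd ->
  figure_of_merit (observed pe pd) <= 5633 / 6090.
Proof.
case=> pe0 pe1 pd0 pd1 peO.
pose f tau := pe tau \o vert; pose q tau := 3^-1 * \sum_(j <- [:: 1; 2; 3]%N) f tau j.
have ff tau : feasible (f tau) (q tau).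
  split=> [j _|l /(nthP [::])[w w18 <-]]; first exact: pe0.
  have := peO tau (Ordinal w18) ord0; rewrite !card_Omega.
  have E w' : \sum_(x in Omega w') pe tau x =
      \sum_(j <- nth [::] Omega_labels w') f tau j.
    by rewrite -sum_Omega; apply: eq_bigr => x _; rewrite /f /= succ_vertK.
  rewrite !E /= => H; rewrite /q -H mulVKf //.
  have /allP/(_ w) :
      all (fun w => size (nth [::] Omega_labels w) != 0)%N (iota 0 18) by [].
  by rewrite mem_iota pnatr_eq0; apply.
rewrite figure_of_meritE mulrC ler_pM2r ?invr_gt0 ?ltr0n //.
(* The averages [q tau] sum to 1, which reduces the bound to one message at a time. *)
have -> : 5633 = \sum_tau 5633 * q tau :> R.
  rewrite -mulr_sumr -mulr_sumr exchange_big.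
  under eq_bigr do rewrite /f /= pe1.
  by rewrite !big_cons big_nil /=; lra.
apply: ler_sum => tau _; have ft := ff tau.
have tot : \sum_(j <- labels)
    (eval (f tau) (piece false j) + eval (f tau) (piece true j)) =
    6090 * q tau.
  rewrite big_split /= -(big_map (piece false) xpredT) -(big_map (piece true) xpredT).
  rewrite -!eval_comb1 !size_map -evalD (eq_eval _ pieces_sum) (eval_comb_Omega _ ft).
  by congr (_ * _); rewrite unlock -[RHS]ofZ_nat.
have := loss_lower_bound ft.
have : \sum_(j <- labels)
    (pd false (vert j) tau * eval (f tau) (piece false j) +
     pd true (vert j) tau * eval (f tau) (piece true j)) <=
  \sum_(j <- labels) (eval (f tau) (piece false j) + eval (f tau) (piece true j)
     - loss (f tau) j).
  (* Bob's value is a convex combination of two terms, hence at most their maximum, which is their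
     sum minus their minimum. *)
  apply: ler_sum => j _.
  have p0 := pd0 false (vert j) tau; have p1 := pd0 true (vert j) tau.
  have E : pd true (vert j) tau = 1 - pd false (vert j) tau.
    by rewrite -(pd1 (vert j) tau) addrAC subrr add0r.
  rewrite {}E in p1 *; rewrite /loss.
  case: (leP (eval (f tau) (piece false j))) => [le_ab|/ltW le_ba].
    by have := mulr_ge0 p0 (etrans (subr_ge0 _ _) le_ab); lra.
  by have := mulr_ge0 p1 (etrans (subr_ge0 _ _) le_ba); lra.
by rewrite sumrB tot; lra.
Qed.

(** * An explicit strategy with twelve messages *)

(* The images of a minimizer of the loss, scaled so that every Omega_w has average
   3, under the alternating group on {10, 11, 12, 13}; each column sums to 36. *)
Definition encoding : seq (seq nat) :=
  [:: [:: 7; 1; 1; 2; 0; 8; 0; 8; 0; 1; 1; 1; 9; 8; 0; 8; 0; 8; 6; 0; 0; 0; 0; 0; 6];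
      [:: 7; 1; 1; 2; 0; 0; 8; 0; 8; 9; 1; 1; 1; 0; 0; 0; 8; 0; 6; 8; 0; 0; 8; 0; 6];
      [:: 7; 1; 1; 0; 2; 8; 0; 0; 8; 1; 9; 1; 1; 6; 0; 0; 0; 0; 8; 6; 8; 0; 0; 8; 0];
      [:: 7; 1; 1; 0; 2; 0; 8; 8; 0; 1; 1; 9; 1; 6; 8; 0; 0; 0; 0; 6; 0; 8; 0; 0; 8];
      [:: 1; 7; 1; 8; 0; 2; 0; 8; 0; 1; 1; 1; 9; 8; 6; 8; 0; 8; 0; 0; 0; 0; 6; 0; 0];
      [:: 1; 7; 1; 8; 0; 0; 2; 0; 8; 9; 1; 1; 1; 0; 0; 6; 8; 0; 0; 8; 6; 0; 8; 0; 0];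
      [:: 1; 7; 1; 0; 8; 2; 0; 0; 8; 1; 9; 1; 1; 0; 6; 0; 0; 0; 8; 0; 8; 0; 6; 8; 0];
      [:: 1; 7; 1; 0; 8; 0; 2; 8; 0; 1; 1; 9; 1; 0; 8; 6; 0; 0; 0; 0; 6; 8; 0; 0; 8];
      [:: 1; 1; 7; 8; 0; 8; 0; 2; 0; 1; 1; 1; 9; 8; 0; 8; 6; 8; 0; 0; 0; 0; 0; 6; 0];
      [:: 1; 1; 7; 8; 0; 0; 8; 0; 2; 9; 1; 1; 1; 0; 0; 0; 8; 6; 0; 8; 0; 6; 8; 0; 0];
      [:: 1; 1; 7; 0; 8; 8; 0; 0; 2; 1; 9; 1; 1; 0; 0; 0; 0; 6; 8; 0; 8; 6; 0; 8; 0];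
      [:: 1; 1; 7; 0; 8; 0; 8; 2; 0; 1; 1; 9; 1; 0; 8; 0; 6; 0; 0; 0; 0; 8; 0; 6; 8]
  ]%N.

Definition entry (t j : nat) : nat := nth 0%N (nth [::] encoding t) j.-1.

(** The value of [L] at message [t], scaled by 36 to stay an integer. *)
Definition tally (t : nat) (L : form) : Z :=
  \sum_(j <- labels) L j * (entry t j)%:R.

Definition score (t : nat) (z : bool) (y : nat) : Z := tally t (piece z y).

Definition best_pe (tau : 'I_12) (x : vertex) : R := (entry tau x.+1)%:R / 36.

(** Bob's deterministic best response; ties go to the answer 1. *)
Definition best_pd (z : bool) (y : vertex) (tau : 'I_12) : R :=
  (z == (score tau false y.+1 <= score tau true y.+1))%:R.

(** Columns of [encoding] sum to 36, which normalises [best_pe]; each row has average 3 on every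
    Omega_w, so all averages equal [3 / 36]. *)
Lemma best_oblivious : oblivious_strategy best_pe best_pd.
Proof.
split=> [tau x|x|z y tau|y tau|tau w w'].
- by rewrite divr_ge0 ?ler0n.
- rewrite -mulr_suml -natr_sum.
  have /allP/(_ _ (succ_labels x)) /eqP :
      all (fun j => sumn [seq entry t j | t <- iota 0 12] == 36)%N labels by vm_compute.
  rewrite sumnE big_map -[iota 0 12]/(index_iota 0 12) big_mkord => ->.
  by rewrite mulfV ?pnatr_eq0.
- by rewrite ler0n.
- by rewrite /best_pd; case: (_ <= _); rewrite ?addr0 ?add0r.
suff H v : (#|Omega v|%:R)^-1 * (\sum_(x in Omega v) best_pe tau x) = 3 / 36 :> R.
  by rewrite !H.
rewrite card_Omega (sum_Omega v (fun j => (entry tau j)%:R / 36)).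
rewrite -mulr_suml -natr_sum.
have /allP/(_ (tau : nat)) : all (fun t => all (fun l =>
    (size l != 0) && (sumn (map (entry t) l) == size l * 3)) Omega_labels)%N (iota 0 12).
  by vm_compute.
rewrite mem_iota ltn_ord => /(_ isT) /allP /(_ _ (mem_Omega_labels v)) /andP[l0 /eqP].
by rewrite sumnE big_map => ->; rewrite natrM mulrA mulKf ?pnatr_eq0.
Qed.

Lemma best_figure_of_merit :
  92 / 100 - 5 / 1000 <= figure_of_merit (observed best_pe best_pd).
Proof.
have E (tau : 'I_12) L : eval (best_pe tau \o vert) L = ofZ (tally tau L) / 36.
  rewrite /eval ofZ_sum mulr_suml; apply: eq_big_seq => j.
  rewrite mem_iota => /andP[j_gt0 j_lt]; rewrite ofZM ofZ_nat -mulrA; congr (_ * _).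
  by rewrite /best_pe /= /vert inordK prednK.
rewrite figure_of_meritE.
rewrite (eq_bigr (fun tau : 'I_12 => ofZ (\sum_(y <- labels)
  Num.max (score tau false y) (score tau true y)) / 36)); last first.
  move=> tau _; rewrite ofZ_sum mulr_suml; apply: eq_big_seq => y.
  rewrite mem_iota => /andP[y_gt0 y_lt].
  rewrite /best_pd !E -/(score tau _ y) /vert inordK prednK //.
  by case: (leP (score tau false y)) => _; rewrite ?mul0r ?mul1r ?add0r ?addr0.
rewrite -mulr_suml -ofZ_sum.
(* The sum over ordinals becomes a sum over a range of naturals, ready for [vm_compute]. *)
rewrite -(big_mkord xpredT (fun t => \sum_(y <- labels)
  Num.max (score t false y) (score t true y))).
set T := \sum_(_ <= _ < _) _.
(* The figure of merit is [T / (6090 * 36)], and [0.915 * 6090 * 36 = 200604.6], so the round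
   threshold 201000 suffices. *)
have T_ge : 2010 * 100 <= T by rewrite /T /score /tally unlock; vm_compute.
have : 2010 * 100 <= ofZ T :> R.
  by rewrite -!(ofZ_nat (R := R)) -ofZM ler_ofZ.
by lra.
Qed.

End Game.

Theorem proposition5 (R : realType) :
  92 / 100 - 5 / 1000 <= S_classical R
    < 92 / 100 + 5 / 1000.
Proof.
(* [ub] bounds the set of values and [best] makes it nonempty, so [sup] is a genuine supremum;
   [5633 / 6090] is just below 0.925. *)
have ub : ubound (classical_values R) (5633 / 6090).
  by move=> _ [L [pe [pd [_ ob ->]]]]; exact: figure_of_merit_le ob.
have best : classical_values R (figure_of_merit (observed best_pe best_pd)).
  by exists 12%N, best_pe, best_pd; split=> //; exact: best_oblivious.
apply/andP; split.
  apply: le_trans (best_figure_of_merit (R := R)) _.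
  by apply: ub_le_sup best; exists (5633 / 6090).
apply: (@le_lt_trans _ _ (5633 / 6090)); last by lra.
by apply: ge_sup ub; eexists; exact: best.
Qed.
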